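(* Let $G$ be an abelian group (with identity $e_G$). 1. The category $\mathbb{H}(G)$ is a simply connected groupoid. 2. The functor $\mathcal{H}(G)\to\mathsf{Ab}$ given by evaluation at $e_G$ is an equivalence of categories. In particular, any system of abelian groups on $G$ is (up to isomorphism) constant. 3. Let $\mathcal{A}\in\mathcal{H}(G)$. If $0\to\mathcal{A}\to N\xrightarrow{\pi}G\to0$ is a coextension, then $N$ is a group and $0\to\mathcal{A}(e_G)\to N\xrightarrow{\pi}G\to0$ is a short exact sequence of abelian groups; and conversely, every short exact sequence of abelian groups $0\to\mathcal{A}(e_G)\to N\xrightarrow{\pi}G\to0$ arises in this way from a coextension of $G$ by $\mathcal{A}$.
   Context: All monoids are commutative. For a monoid $M$, $\mathbb{H}(M)$ is the category whose objects are the elements of $M$ and whose morphisms $a\to b$ are the pairs $(r,a)$, $r\in M$, with $b=ra$, composed by multiplication. A system of abelian groups over $M$ is a functor $\mathcal{A}:\mathbb{H}(M)\to\mathsf{Ab}$; the induced maps are written $r_*:\mathcal{A}(a)\to\mathcal{A}(ra)$. $\mathcal{H}(M)$ is the category of systems with natural transformations. A groupoid is simply connected if every pair of objects is connected by exactly one isomorphism. A coextension $0\to\mathcal{A}\to N\xrightarrow{\pi}M\to0$ is a surjective homomorphism of commutative monoids $\pi:N\to M$ with an action $\bullet$ of the group $\mathcal{A}(m)$ on $\pi^{-1}(m)$ for each $m\in M$ such that (i) for $n,n'\in\pi^{-1}(m)$ there is a unique $x\in\mathcal{A}(m)$ with $n'=x\bullet n$; (ii) $(x\bullet n)(y\bullet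 n')=(m'_*(x)+m_*(y))\bullet(nn')$ for $x\in\mathcal{A}(m)$, $n\in\pi^{-1}(m)$, $y\in\mathcal{A}(m')$, $n'\in\pi^{-1}(m')$. In part 3 the map $\mathcal{A}(e_G)\to N$ is $x\mapsto x\bullet1_N$. *)

(* Defs.v *)
From mathcomp Require Import all_boot all_algebra.
From mathcomp Require Import boolp.

(* Commutative monoids are [nmodType]s and abelian groups are
   [zmodType]s, both written additively: the product [ra] of the monoid reads
   [r + a] and the identity [e_G] reads [0]. *)

Set Implicit Arguments.
Unset Strict Implicit.
Unset Printing Implicit Defensive.

Import GRing.Theory.
Local Open Scope ring_scope.

Record category := Category {
  obj :> Type;
  hom : obj -> obj -> Type;
  idm : forall a, hom a a;
  comp : forall a b c, hom b c -> hom a b -> hom a c;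
  comp_idl : forall a b (f : hom a b), comp (idm b) f = f;
  comp_idr : forall a b (f : hom a b), comp f (idm a) = f;
  comp_assoc : forall a b c d (h : hom c d) (g : hom b c) (f : hom a b),
    comp h (comp g f) = comp (comp h g) f }.
Arguments idm {C} a : rename.
Arguments comp {C a b c} g f : rename.

Definition is_iso (C : category) (a b : C) (f : hom a b) : Prop :=
  exists g : hom b a, comp g f = idm a /\ comp f g = idm b.

Definition isomorphic (C : category) (a b : C) : Prop :=
  exists f : hom a b, is_iso f.

Definition is_groupoid (C : category) : Prop :=
  forall (a b : C) (f : hom a b), is_iso f.

Definition simply_connected (C : category) : Prop :=
  forall a b : C, exists! f : hom a b, is_iso f.

Record functor (C D : category) := Functor {
  fobj :> C -> D;
  fmap : forall a b, hom a b -> hom (fobj a) (fobj b);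
  fmap_id : forall a, fmap (idm a) = idm (fobj a);
  fmap_comp : forall a b c (g : hom b c) (f : hom a b),
    fmap (comp g f) = comp (fmap g) (fmap f) }.
Arguments fmap {C D} F {a b} f : rename.

Record nat_trans (C D : category) (F G : functor C D) := NatTrans {
  component :> forall a : C, hom (F a) (G a);
  naturality : forall (a b : C) (f : hom a b),
    comp (component b) (fmap F f) = comp (fmap G f) (component a) }.

Lemma nat_trans_ext (C D : category) (F G : functor C D)
    (s t : nat_trans F G) : (forall a, s a = t a) -> s = t.
Proof.
case: s t => s Hs [t Ht] /= st.
have {}st : s = t by apply: functional_extensionality_dep.
by case: t / st Ht => Ht; congr NatTrans; apply: Prop_irrelevance.
Qed.

Section FunctorCategory.
Variables C D : category.
Implicit Types F G H : functor C D.

Fact nat_id_natural F (a b : C) (f : hom a b) :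
  comp (idm (F b)) (fmap F f) = comp (fmap F f) (idm (F a)).
Proof. by rewrite comp_idl comp_idr. Qed.

Definition nat_id F : nat_trans F F := NatTrans (@nat_id_natural F).

Fact nat_comp_natural F G H (t : nat_trans G H) (s : nat_trans F G)
    (a b : C) (f : hom a b) :
  comp (comp (t b) (s b)) (fmap F f) = comp (fmap H f) (comp (t a) (s a)).
Proof. by rewrite -comp_assoc naturality !comp_assoc naturality. Qed.

Definition nat_comp F G H (t : nat_trans G H) (s : nat_trans F G) :
  nat_trans F H := NatTrans (nat_comp_natural t s).

Fact nat_comp_idl F G (s : nat_trans F G) : nat_comp (nat_id G) s = s.
Proof. by apply: nat_trans_ext => a; apply: comp_idl. Qed.

Fact nat_comp_idr F G (s : nat_trans F G) : nat_comp s (nat_id F) = s.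
Proof. by apply: nat_trans_ext => a; apply: comp_idr. Qed.

Fact nat_comp_assoc F G H K (u : nat_trans H K) (t : nat_trans G H)
    (s : nat_trans F G) :
  nat_comp u (nat_comp t s) = nat_comp (nat_comp u t) s.
Proof. by apply: nat_trans_ext => a; apply: comp_assoc. Qed.

Definition functor_cat : category :=
  Category nat_comp_idl nat_comp_idr nat_comp_assoc.

Definition eval_functor (c : C) : functor functor_cat D :=
  @Functor functor_cat D (fun F : functor C D => F c)
    (fun F G (s : nat_trans F G) => s c)
    (fun F => erefl) (fun F G H t s => erefl).

Definition const_functor (d : D) : functor C D :=
  @Functor C D (fun=> d) (fun _ _ _ => idm d)
    (fun=> erefl) (fun _ _ _ _ _ => esym (comp_idl (idm d))).

End FunctorCategory.

Definition id_functor (C : category) : functor C C :=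
  @Functor C C id (fun _ _ f => f) (fun=> erefl) (fun _ _ _ _ _ => erefl).

Section FunctorComposition.
Variables (C D E : category) (G : functor D E) (F : functor C D).

Fact comp_functor_id (a : C) : fmap G (fmap F (idm a)) = idm (G (F a)).
Proof. by rewrite !fmap_id. Qed.

Fact comp_functor_comp (a b c : C) (g : hom b c) (f : hom a b) :
  fmap G (fmap F (comp g f)) =
  comp (fmap G (fmap F g)) (fmap G (fmap F f)).
Proof. by rewrite !fmap_comp. Qed.

Definition comp_functor : functor C E :=
  @Functor C E (fun a => G (F a)) (fun a b f => fmap G (fmap F f))
    comp_functor_id comp_functor_comp.

End FunctorComposition.

Definition is_equivalence (C D : category) (F : functor C D) : Prop :=
  exists G : functor D C,
    @isomorphic (functor_cat C C) (comp_functor G F) (id_functor C) /\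
    @isomorphic (functor_cat D D) (comp_functor F G) (id_functor D).

Lemma additive_ext (U V : zmodType) (f g : {additive U -> V}) :
  f =1 g -> f = g.
Proof.
case: f g => f [[Hf]] [g [[Hg]]] /= fg.
have {}fg : f = g by apply: funext.
case: g / fg Hg => Hg.
by rewrite (Prop_irrelevance Hf Hg).
Qed.

Definition Ab_id (U : zmodType) : {additive U -> U} := idfun.
Definition Ab_comp (U V W : zmodType) (g : {additive V -> W})
  (f : {additive U -> V}) : {additive U -> W} := g \o f.

Fact Ab_comp_idl (U V : zmodType) (f : {additive U -> V}) :
  Ab_comp (Ab_id V) f = f.
Proof. exact: additive_ext. Qed.

Fact Ab_comp_idr (U V : zmodType) (f : {additive U -> V}) :
  Ab_comp f (Ab_id U) = f.
Proof. exact: additive_ext. Qed.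

Fact Ab_comp_assoc (U V W X : zmodType) (h : {additive W -> X})
    (g : {additive V -> W}) (f : {additive U -> V}) :
  Ab_comp h (Ab_comp g f) = Ab_comp (Ab_comp h g) f.
Proof. exact: additive_ext. Qed.

Definition Ab : category := Category Ab_comp_idl Ab_comp_idr Ab_comp_assoc.

Section MonoidCategory.
Variable M : nmodType.

(* The morphism [(r, a) : a -> ra]; the source [a] is recorded in the type. *)
Definition Hhom (a b : M) : Type := {r : M | b == r + a}.

Fact Hid_subproof (a : M) : a == 0 + a. Proof. by rewrite add0r. Qed.
Definition Hid (a : M) : Hhom a a := exist _ 0 (Hid_subproof a).

Fact Hcomp_subproof (a b c : M) (s : Hhom b c) (r : Hhom a b) :
  c == val s + val r + a.
Proof. by rewrite -addrA -(eqP (valP r)) (valP s). Qed.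
Definition Hcomp (a b c : M) (s : Hhom b c) (r : Hhom a b) : Hhom a c :=
  exist _ (val s + val r) (Hcomp_subproof s r).

Fact Hcomp_idl (a b : M) (r : Hhom a b) : Hcomp (Hid b) r = r.
Proof. by apply: val_inj; rewrite /= add0r. Qed.

Fact Hcomp_idr (a b : M) (r : Hhom a b) : Hcomp r (Hid a) = r.
Proof. by apply: val_inj; rewrite /= addr0. Qed.

Fact Hcomp_assoc (a b c d : M) (t : Hhom c d) (s : Hhom b c) (r : Hhom a b) :
  Hcomp t (Hcomp s r) = Hcomp (Hcomp t s) r.
Proof. by apply: val_inj; rewrite /= addrA. Qed.

Definition Hcat : category := Category Hcomp_idl Hcomp_idr Hcomp_assoc.

Definition system : Type := functor Hcat Ab.
Definition systems : category := functor_cat Hcat Ab.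

Definition sys_group (A : system) (m : M) : zmodType := fobj A m.

(* The induced map [r_*], with target [A b] for any [b] equal to [ra], so that
   [m'm] and [mm'] need no transport. *)
Definition push (A : system) (r a b : M) (e : b == r + a) :
    {additive sys_group A a -> sys_group A b} :=
  @fmap Hcat Ab A a b (exist _ r e).

End MonoidCategory.

Coercion sys_group : system >-> Funclass.

Section Coextension.
Variables (M : nmodType) (A : system M) (N : nmodType).
Variable pi : {additive N -> M}.

Definition fiber (m : M) : Type := {n : N | pi n == m}.

Fact fiber0_subproof : pi 0 == 0. Proof. by rewrite raddf0. Qed.
Definition fiber0 : fiber 0 := exist _ 0 fiber0_subproof.

Fact fiberD_subproof (m m' : M) (n : fiber m) (n' : fiber m') :
  pi (val n + val n') == m + m'.
Proof. by rewrite raddfD (eqP (valP n)) (eqP (valP n')). Qed.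
Definition fiberD (m m' : M) (n : fiber m) (n' : fiber m') : fiber (m + m') :=
  exist _ (val n + val n') (fiberD_subproof n n').

Fact addC_eq (m m' : M) : m + m' == m' + m. Proof. by rewrite addrC. Qed.

Record coextension := Coextension {
  coext_surj : forall m : M, exists n : N, pi n = m;
  coext_act : forall m : M, A m -> fiber m -> fiber m;
  coext_act0 : forall (m : M) (n : fiber m), coext_act 0 n = n;
  coext_actD : forall (m : M) (x y : A m) (n : fiber m),
    coext_act (x + y) n = coext_act x (coext_act y n);
  coext_torsor : forall (m : M) (n n' : fiber m),
    exists! x : A m, n' = coext_act x n;
  coext_mul : forall (m m' : M) (x : A m) (n : fiber m)
      (y : A m') (n' : fiber m'),
    fiberD (coext_act x n) (coext_act y n') =
    coext_act (push A (addC_eq m m') x + push A (eqxx (m + m')) y)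
              (fiberD n n') }.

Definition coext_incl (E : coextension) (x : A 0) : N :=
  val (coext_act E x fiber0).

End Coextension.

Definition is_group (N : nmodType) : Prop :=
  forall n : N, exists n' : N, n' + n = 0.

(* [is_group] makes the commutative monoids [U], [N], [V] abelian groups. *)
Record short_exact (U N V : nmodType) (i : U -> N) (p : N -> V) : Prop :=
  ShortExact {
    ses_groups : [/\ is_group U, is_group N & is_group V];
    ses_homl : nmod_morphism i;
    ses_homr : nmod_morphism p;
    ses_inj : injective i;
    ses_exact : forall n : N, p n = 0 <-> exists u : U, i u = n;
    ses_surj : forall v : V, exists n : N, p n = v }.

(* Main.v *)
From mathcomp Require Import all_boot all_algebra.
From mathcomp Require Import boolp.
Require Import Defs.

(** For an abelian group [G], a morphism [a -> b] of [Hcat G] is an [r] with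
    [b = r + a], so [r = b - a] is the only one and its inverse is [- r]: this
    is part 1.

    Part 2 holds for functors out of any simply connected groupoid [C] with a
    chosen object [c]. Sending [d] to the constant functor at [d] is quasi-inverse
    to evaluation at [c]: the images under [F] of the unique arrows [c -> a] form
    an isomorphism from the constant functor at [F c] to [F], natural in [a]
    because two parallel arrows of [C] coincide, and natural in [F] because a
    morphism of functors commutes with the image of [c -> a]
    ([const_eval_isomorphic]).

    Part 3 rests on the same rigidity: all the groups [A m] are canonically
    identified with [A 0]. Given a coextension, the action of [A 0] on the fiber
    over [0] moves [0] to the points of a copy of [A 0] in [N]; condition (ii) at
    [m = m' = 0] says that the copy is embedded additively, and the torsor
    condition (i) that it is exactly the kernel of [pi]. An inverse of [n] is
    obtained by correcting a lift of [- pi n] by an element of this kernel.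
    Conversely, an extension of [G] by [A 0] becomes a coextension when [A m] acts
    by translation through [A m ~ A 0 -> N]; condition (ii) reduces to the
    compatibility of the canonical identifications ([coext_of_ses]). *)

Set Implicit Arguments.
Unset Strict Implicit.
Unset Printing Implicit Defensive.

Import GRing.Theory.
Local Open Scope ring_scope.

(** * Functors on a simply connected groupoid *)

Lemma isomorphic_sym (C : category) (a b : C) :
  isomorphic a b -> isomorphic b a.
Proof. by case=> f [g [gf fg]]; exists g, f. Qed.

(** The componentwise inverses are automatically natural. *)
Lemma nat_iso (C D : category) (F G : functor C D) (t : nat_trans F G) :
  (forall a, is_iso (t a)) -> @is_iso (functor_cat C D) F G t.
Proof.
move=> t_iso; pose s a := projT1 (cid (t_iso a)).
have st a : comp (s a) (t a) = idm (F a) /\ comp (t a) (s a) = idm (G a).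
  exact: projT2 (cid (t_iso a)).
have s_nat (a b : C) (f : hom a b) :
    comp (s b) (fmap G f) = comp (fmap F f) (s a).
  rewrite -[LHS]comp_idr -(st a).2 comp_assoc -[comp (comp (s b) _) (t a)]comp_assoc.
  by rewrite -naturality comp_assoc (st b).1 comp_idl.
by exists (NatTrans s_nat); split; apply: nat_trans_ext => a /=; case: (st a).
Qed.

Lemma fmap_iso (C D : category) (F : functor C D) (a b : C) (f : hom a b) :
  is_iso f -> is_iso (fmap F f).
Proof.
by case=> g [gf fg]; exists (fmap F g); rewrite -!fmap_comp gf fg !fmap_id.
Qed.

Section Diagonal.
Variables C D : category.

Fact diag_natural (d d' : D) (f : hom d d') (a b : C) (u : hom a b) :
  comp f (fmap (const_functor C d) u) = comp (fmap (const_functor C d') u) f.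
Proof. by rewrite /= comp_idl comp_idr. Qed.

Definition diag_trans (d d' : D) (f : hom d d') :
    nat_trans (const_functor C d) (const_functor C d') :=
  @NatTrans C D (const_functor C d) (const_functor C d') (fun=> f)
    (diag_natural f).

Fact diag_id (d : D) :
  diag_trans (idm d) = @idm (functor_cat C D) (const_functor C d).
Proof. exact: nat_trans_ext. Qed.

Fact diag_comp (d d' d'' : D) (g : hom d' d'') (f : hom d d') :
  diag_trans (comp g f) =
  @comp (functor_cat C D) _ _ _ (diag_trans g) (diag_trans f).
Proof. exact: nat_trans_ext. Qed.

Definition diag_functor : functor D (functor_cat C D) :=
  @Functor D (functor_cat C D) (@const_functor C D) diag_trans diag_id diag_comp.

End Diagonal.

Section SimplyConnected.
Variables C D : category.
Hypothesis C_groupoid : is_groupoid C.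
Hypothesis C_connected : simply_connected C.
Variable c : C.

Lemma parallel_eq (a b : C) (f g : hom a b) : f = g.
Proof.
have [h [_ h_unique]] := C_connected a b.
by rewrite -(h_unique f (C_groupoid f)) -(h_unique g (C_groupoid g)).
Qed.

(** The contraction of [C] onto [c]. *)
Definition arrow_from (a : C) : hom c a := projT1 (cid (C_connected c a)).

Fact const_to_natural (F : functor C D) (a b : C) (f : hom a b) :
  comp (fmap F (arrow_from b)) (fmap (const_functor C (F c)) f) =
  comp (fmap F f) (fmap F (arrow_from a)).
Proof.
by rewrite /= comp_idr -fmap_comp; congr (fmap F _); apply: parallel_eq.
Qed.

Definition const_to (F : functor C D) : nat_trans (const_functor C (F c)) F :=
  NatTrans (const_to_natural F).

Lemma const_to_iso (F : functor C D) :
  @is_iso (functor_cat C D) _ _ (const_to F).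
Proof. by apply: nat_iso => a; apply/fmap_iso/C_groupoid. Qed.

Lemma const_eval_isomorphic :
  @isomorphic (functor_cat (functor_cat C D) (functor_cat C D))
    (comp_functor (diag_functor C D) (eval_functor D c))
    (id_functor (functor_cat C D)).
Proof.
have const_to_nat (F G : functor C D) (s : nat_trans F G) :
    nat_comp (const_to G) (diag_trans C (s c)) = nat_comp s (const_to F).
  by apply: nat_trans_ext => a /=; rewrite naturality.
exists (@NatTrans _ _
  (comp_functor (diag_functor C D) (eval_functor D c)) (id_functor _)
  const_to const_to_nat).
by apply: nat_iso => F; apply: const_to_iso.
Qed.

Lemma eval_const_isomorphic :
  @isomorphic (functor_cat D D)
    (comp_functor (eval_functor D c) (diag_functor C D)) (id_functor D).
Proof.
have id_nat (d d' : D) (f : hom d d') : comp (idm d') f = comp f (idm d).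
  by rewrite comp_idl comp_idr.
exists (@NatTrans _ _ (comp_functor (eval_functor D c) (diag_functor C D))
  (id_functor D) (@idm D) id_nat).
by apply: nat_iso => d; exists (idm d); rewrite /= comp_idl.
Qed.

Lemma eval_equivalence : is_equivalence (eval_functor D c).
Proof.
exists (diag_functor C D).
by split; [apply: const_eval_isomorphic | apply: eval_const_isomorphic].
Qed.

Lemma functor_constant (F : functor C D) :
  @isomorphic (functor_cat C D) F (const_functor C (F c)).
Proof. by apply: isomorphic_sym; exists (const_to F); apply: const_to_iso. Qed.

End SimplyConnected.

(** * The category of an abelian group *)

Lemma Hcat_parallel (G : zmodType) (a b : G) (f g : Hhom a b) : f = g.
Proof.
by apply: val_inj; apply: (addIr a); rewrite -(eqP (valP f)) -(eqP (valP g)).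
Qed.

Lemma Hcat_groupoid (G : zmodType) : is_groupoid (Hcat G).
Proof.
move=> a b f.
have inv_eq : a == - val f + b by rewrite [in X in _ + X](eqP (valP f)) addKr.
by exists (exist _ (- val f) inv_eq); split; apply: Hcat_parallel.
Qed.

Lemma Hcat_simply_connected (G : zmodType) : simply_connected (Hcat G).
Proof.
move=> a b; have sub_eq : b == b - a + a by rewrite subrK.
exists (exist _ (b - a) sub_eq : Hhom a b).
by split=> [|f _]; [apply: Hcat_groupoid | apply: Hcat_parallel].
Qed.

(** * Induced maps of a system *)

Lemma push0 (M : nmodType) (A : system M) (a : M) (e : a == 0 + a) (x : A a) :
  push A e x = x.
Proof.
rewrite (bool_irrelevance e (Hid_subproof a)).
by rewrite /push (fmap_id (A : functor _ _)).
Qed.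

Section PushGroup.
Variables (G : zmodType) (A : system G).

(** Functoriality gives this for [t = s + r] only; since parallel arrows of
    [Hcat G] coincide, any [t] with the right endpoints will do. *)
Lemma push_push (r s t a b d : G) (e : b == r + a) (e' : d == s + b)
    (e'' : d == t + a) (x : A a) :
  push A e' (push A e x) = push A e'' x.
Proof.
pose f : @hom (Hcat G) a b := exist _ r e.
pose g : @hom (Hcat G) b d := exist _ s e'.
have -> : push A e'' = fmap (A : functor _ _) (comp g f).
  by rewrite /push (Hcat_parallel (exist _ t e'') (comp g f)).
by rewrite fmap_comp.
Qed.

Fact to_origin_eq (m : G) : 0 == - m + m. Proof. by rewrite addNr. Qed.
Fact from_origin_eq (m : G) : m == m + 0. Proof. by rewrite addr0. Qed.

Definition to_origin (m : G) : {additive A m -> A 0} := push A (to_origin_eq m).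
Definition from_origin (m : G) : {additive A 0 -> A m} :=
  push A (from_origin_eq m).

Lemma push_loop (r a : G) (e : a == r + a) (x : A a) : push A e x = x.
Proof.
have r0 : r = 0 by apply: (addIr a); rewrite add0r -(eqP e).
by move: e; rewrite r0 => e; apply: push0.
Qed.

Lemma from_originK (m : G) : cancel (from_origin m) (to_origin m).
Proof.
by move=> x; rewrite /to_origin (push_push _ _ (Hid_subproof 0)) push0.
Qed.

Lemma to_originK (m : G) : cancel (to_origin m) (from_origin m).
Proof.
by move=> x; rewrite /from_origin (push_push _ _ (Hid_subproof m)) push0.
Qed.

Lemma to_origin_push (r a b : G) (e : b == r + a) (x : A a) :
  to_origin b (push A e x) = to_origin a x.
Proof. exact: push_push. Qed.

End PushGroup.

(** * From coextensions to extensions *)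

(** Condition (ii) with the fiber of the product named by any [d] equal to
    [m + m']; at [m = m' = 0] this allows [d] to be [0] instead of [0 + 0]. *)
Lemma coext_mulE (M : nmodType) (A : system M) (N : nmodType)
    (pi : {additive N -> M}) (E : coextension A pi) (m m' d : M)
    (x : A m) (n : fiber pi m) (y : A m') (n' : fiber pi m') (k : fiber pi d)
    (e : d == m' + m) (e' : d == m + m') :
  val k = val n + val n' ->
  val (coext_act E x n) + val (coext_act E y n') =
  val (coext_act E (push A e x + push A e' y) k).
Proof.
have d_eq := eqP e'; move: k e e'; rewrite d_eq => k e e' k_val.
have -> : k = fiberD n n' by apply: val_inj.
rewrite (bool_irrelevance e (addC_eq m m')) (bool_irrelevance e' (eqxx _)).
by rewrite -coext_mul.
Qed.

Section CoextensionOfGroup.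
Variables (G : zmodType) (A : system G) (N : nmodType).
Variables (pi : {additive N -> G}) (E : coextension A pi).

Lemma coext_incl_morphism : nmod_morphism (coext_incl E).
Proof.
split=> [|x y]; first by rewrite /coext_incl coext_act0.
have zero_eq : (0 : G) == 0 + 0 by rewrite addr0.
rewrite /coext_incl (@coext_mulE _ _ _ _ E _ _ 0 x _ y _ (fiber0 pi)
  zero_eq zero_eq) ?push0 //=.
by rewrite addr0.
Qed.

Lemma coext_incl_inj : injective (coext_incl E).
Proof.
move=> x y /val_inj xy.
have [z [_ z_unique]] := coext_torsor E (fiber0 pi) (coext_act E x (fiber0 pi)).
by rewrite -(z_unique x erefl) -(z_unique y xy).
Qed.

Lemma coext_incl_exact (n : N) : pi n = 0 <-> exists u, coext_incl E u = n.
Proof.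
split=> [/eqP pin0 | [u <-]]; last exact/eqP/(valP (coext_act E u _)).
pose k : fiber pi 0 := exist _ n pin0.
have [x [kx _]] := coext_torsor E (fiber0 pi) k.
by exists x; rewrite -[n]/(val k) kx.
Qed.

(** If [m] lifts [- pi n] then [m + n] lies in the kernel, which is a group. *)
Lemma coext_is_group : is_group N.
Proof.
move=> n; have [m pim] := coext_surj E (- pi n).
have /coext_incl_exact[x mn] : pi (m + n) = 0 by rewrite raddfD /= pim addNr.
have [incl0 inclD] := coext_incl_morphism.
by exists (coext_incl E (- x) + m); rewrite -addrA -mn -inclD addNr.
Qed.

End CoextensionOfGroup.

Lemma zmod_is_group (U : zmodType) : is_group U.
Proof. by move=> u; exists (- u); rewrite addNr. Qed.

Lemma coext_short_exact (G : zmodType) (A : system G) (N : nmodType)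
    (pi : {additive N -> G}) (E : coextension A pi) :
  short_exact (coext_incl E) pi.
Proof.
split.
- split; [exact: zmod_is_group | exact: coext_is_group E |].
  exact: zmod_is_group.
- exact: coext_incl_morphism.
- by split; [apply: raddf0 | apply: raddfD].
- exact: coext_incl_inj.
- exact: coext_incl_exact.
- exact: coext_surj E.
Qed.

(** * From extensions to coextensions *)

Section CoextensionOfSes.
Variables (G : zmodType) (A : system G) (N : zmodType).
Variables (i : {additive A 0 -> N}) (pi : {additive N -> G}).
Hypothesis ses : short_exact i pi.

Fact ses_act_subproof (m : G) (x : A m) (n : fiber pi m) :
  pi (i (to_origin A m x) + val n) == m.
Proof.
have pi_i u : pi (i u) = 0 by apply/(ses_exact ses); exists u.
by rewrite raddfD /= pi_i add0r (valP n).
Qed.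

Definition ses_act (m : G) (x : A m) (n : fiber pi m) : fiber pi m :=
  exist _ (i (to_origin A m x) + val n) (ses_act_subproof x n).

Fact ses_act0 (m : G) (n : fiber pi m) : ses_act 0 n = n.
Proof. by apply: val_inj; rewrite /= !raddf0 add0r. Qed.

Fact ses_actD (m : G) (x y : A m) (n : fiber pi m) :
  ses_act (x + y) n = ses_act x (ses_act y n).
Proof. by apply: val_inj; rewrite /= !raddfD /= addrA. Qed.

Fact ses_torsor (m : G) (n n' : fiber pi m) :
  exists! x : A m, n' = ses_act x n.
Proof.
have /(ses_exact ses)[u iu] : pi (val n' - val n) = 0.
  by rewrite raddfB /= (eqP (valP n)) (eqP (valP n')) subrr.
exists (from_origin A m u); split=> [|x n'x].
  by apply: val_inj; rewrite /= from_originK iu subrK.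
apply: (can_inj (@to_originK _ A m)); rewrite from_originK.
by apply: (ses_inj ses); rewrite iu n'x /= addrK.
Qed.

Fact ses_mul (m m' : G) (x : A m) (n : fiber pi m) (y : A m')
    (n' : fiber pi m') :
  fiberD (ses_act x n) (ses_act y n') =
  ses_act (push A (addC_eq m m') x + push A (eqxx (m + m')) y) (fiberD n n').
Proof.
by apply: val_inj; rewrite /= raddfD /= !to_origin_push raddfD /= addrACA.
Qed.

Definition coext_of_ses : coextension A pi :=
  Coextension (ses_surj ses) ses_act0 ses_actD ses_torsor ses_mul.

Lemma coext_of_ses_incl (x : A 0) : coext_incl coext_of_ses x = i x.
Proof. by rewrite /coext_incl /= addr0 /to_origin push_loop. Qed.

End CoextensionOfSes.

Theorem proposition3p4 (G : zmodType) :
  (is_groupoid (Hcat G) /\ simply_connected (Hcat G)) /\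
  (is_equivalence (eval_functor Ab (0 : Hcat G) : functor (systems G) Ab) /\
   (forall A : system G, exists B : zmodType,
      @isomorphic (systems G) A (const_functor (Hcat G) (B : Ab)))) /\
  (forall A : system G,
     (forall (N : nmodType) (pi : {additive N -> G}) (E : coextension A pi),
        is_group N /\ short_exact (coext_incl E) pi) /\
     (forall (N : zmodType) (i : {additive A 0 -> N}) (pi : {additive N -> G}),
        short_exact i pi ->
        exists E : coextension A pi, forall x : A 0, coext_incl E x = i x)).
Proof.
have gpd := @Hcat_groupoid G; have conn := @Hcat_simply_connected G.
split; first by [].
split.
  split; first exact: eval_equivalence.
  by move=> A; exists (A 0); apply: functor_constant.
move=> A; split=> [N pi E | N i pi ses].
  by split; [apply: coext_is_group E | apply: coext_short_exact].
by exists (coext_of_ses ses); apply: coext_of_ses_incl.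
Qed.
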